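(* Fix $K\ge 1$ and a parameter value $\boldsymbol{\eta}_r$, with targets of inference $\boldsymbol{\theta}_r=(\theta_{r,1},\dots,\theta_{r,K})=g(\boldsymbol{\eta}_r)$. Assume the data model $f(\boldsymbol{y};\boldsymbol{\eta}_r)$ satisfies the standard regularity conditions for asymptotic normality of the maximum likelihood estimator, and the prior $p(\boldsymbol{\eta})$ satisfies the standard conditions of the Bernstein–von Mises theorem. Let $\mathcal{I}(\boldsymbol{\theta}_r)$ be the Fisher information with respect to $\boldsymbol{\theta}$, assumed positive definite, and write $\mathcal{I}_{k,k}(\boldsymbol{\theta}_r)^{-1}$ for the $(k,k)$ entry of $\mathcal{I}(\boldsymbol{\theta}_r)^{-1}$. For each $k$, let $-\infty\le\delta_{L,k}<\delta_{U,k}\le\infty$. Fix a point $\boldsymbol{u}_r=(u_{r,1},\dots,u_{r,K})\in[0,1]^K$. For each sample size $n$, define $\hat{\boldsymbol{\theta}}^{(n)}_r=(\hat\theta^{(n)}_{r,1},\dots,\hat\theta^{(n)}_{r,K})$ by conditional CDF inversion of the $K$-variate normal distribution $\mathcal{N}\big(\boldsymbol{\theta}_r,\ n^{-1}\mathcal{I}(\boldsymbol{\theta}_r)^{-1}\big)$. That is, $\hat\theta^{(n)}_{r,1}$ is the $u_{r,1}$-quantile of the first marginal of this distribution, and for $k\ge2$, $\hat\theta^{(n)}_{r,k}$ is the $u_{r,k}$-quantile of the conditional distribution of the $k$-th component given that the first $k-1$ components equal $\hat\theta^{(n)}_{r,1},\dots,\hat\theta^{(n)}_{r,k-1}$. Define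 $$p^{(n)}_{r,k}=\Phi\!\left(\frac{\delta_{U,k}-\hat\theta^{(n)}_{r,k}}{\sqrt{n^{-1}\mathcal{I}_{k,k}(\boldsymbol{\theta}_r)^{-1}}}\right)-\Phi\!\left(\frac{\delta_{L,k}-\hat\theta^{(n)}_{r,k}}{\sqrt{n^{-1}\mathcal{I}_{k,k}(\boldsymbol{\theta}_r)^{-1}}}\right),$$ where $\Phi$ is the standard normal CDF. Write $p^{(n)}_{r,k}\mid\{p^{(n)}_{r,h}\}_{h=1}^{k-1}$ for this quantity regarded as a function of $n$, with $\hat\theta^{(n)}_{r,k}$ generated conditionally on the previously generated components as described. For $k=1$ the conditioning set is empty. Then for each $k=1,\dots,K$: (a) $p^{(n)}_{r,k}\mid\{p^{(n)}_{r,h}\}_{h=1}^{k-1}=\Phi\big(a_k(\delta_{U,k},\boldsymbol{\theta}_r)\sqrt{n}+b_k(\{u_{r,h}\}_{h=1}^k)\big)-\Phi\big(a_k(\delta_{L,k},\boldsymbol{\theta}_r)\sqrt{n}+b_k(\{u_{r,h}\}_{h=1}^k)\big)$. Here $a_k(\delta,\boldsymbol{\theta}_r)=(\delta-\theta_{r,k})/\sqrt{\mathcal{I}_{k,k}(\boldsymbol{\theta}_r)^{-1}}$, and $b_k(\cdot)$ does not depend on $n$. (b) With $\mathrm{logit}(x)=\log(x)-\log(1-x)$, $$\lim_{n\to\infty}\frac{d}{dn}\,\mathrm{logit}\Big(p^{(n)}_{r,k}\mid\{p^{(n)}_{r,h}\}_{h=1}^{k-1}\Big)=\big(0.5-\mathbb{I}\{\theta_{r,k}\notin(\delta_{L,k},\delta_{U,k})\}\big)\times\min\{a_k(\delta_{U,k},\boldsymbol{\theta}_r)^2,\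 a_k(\delta_{L,k},\boldsymbol{\theta}_r)^2\}.$$
   Context: Setting: data $\boldsymbol{Y}^{(n)}=\{\boldsymbol{Y}_i\}_{i=1}^n$ are generated independently from a parametric model $f(\boldsymbol{y};\boldsymbol{\eta})$ for an A/B test, with parameter vector $\boldsymbol{\eta}$. The targets of inference are $\boldsymbol{\theta}=g(\boldsymbol{\eta})=(g_1(\boldsymbol{\eta}),\dots,g_K(\boldsymbol{\eta}))$, and for each metric $k$ the hypothesis of interest is $H_{1,k}:\theta_k\in(\delta_{L,k},\delta_{U,k})$. By the Bernstein–von Mises theorem, the posterior of $\boldsymbol{\theta}$ is approximately $\mathcal{N}(\hat{\boldsymbol{\theta}}^{(n)},\mathcal{I}(\boldsymbol{\theta})^{-1}/n)$, where $\hat{\boldsymbol{\theta}}^{(n)}$ is the MLE. The quantity $p^{(n)}_{r,k}$ is the resulting large-sample proxy for the posterior probability of $H_{1,k}$, evaluated at a proxy MLE value generated from the approximate sampling distribution of the MLE, $\mathcal{N}(\boldsymbol{\theta}_r,n^{-1}\mathcal{I}(\boldsymbol{\theta}_r)^{-1})$, using the fixed point $\boldsymbol{u}_r$. $\mathbb{I}\{\cdot\}$ denotes the indicator function.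
   Formalization: The point u_r is taken in the open cube (0,1)^K, since at 0 or 1 the quantile is infinite and logit p is undefined; part (b) excludes δ_L = −∞ together with δ_U = +∞, where p is identically 1 and logit p is undefined. *)

(* Defs.v *)
From HB Require Import structures.
From mathcomp Require Import all_boot all_order all_algebra.
From mathcomp Require Import all_classical all_reals all_analysis.
Set Implicit Arguments. Unset Strict Implicit. Unset Printing Implicit Defensive.
Import Order.TTheory GRing.Theory Num.Theory.
Import numFieldNormedType.Exports.
Local Open Scope classical_set_scope.
Local Open Scope ring_scope.

Section Defs.
Context {R : realType}.

Definition std_normal_pdf (s : R) : R :=
  expR (- (s ^+ 2) / 2) / Num.sqrt (2 * pi).
Definition Phi (x : R) : R :=
  fine (\int[lebesgue_measure]_(s in [set s : R | s <= x]) (std_normal_pdf s)%:E).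
Definition Phi_ext (x : \bar R) : R :=
  match x with EFin r => Phi r | +oo%E => 1 | -oo%E => 0 end.

Definition logit (x : R) : R := ln x - ln (1 - x).

Definition posdef (K : nat) (M : 'M[R]_K) : Prop :=
  M^T = M /\ forall v : 'rV[R]_K, v != 0 -> 0 < (v *m M *m v^T) ord0 ord0.

Definition gauss_dens (j : nat) (m : 'rV[R]_j) (C : 'M[R]_j) (y : 'rV[R]_j) : R :=
  expR (- ((y - m) *m invmx C *m (y - m)^T) ord0 ord0 / 2)
  / Num.sqrt ((2 * pi) ^+ j * \det C).

Definition vf (K : nat) (v : 'I_K -> R) (i : nat) : R :=
  if insub i is Some a then v a else 0.
Definition mf (K : nat) (M : 'M[R]_K) (i l : nat) : R :=
  match insub i, insub l with Some a, Some b => M a b | _, _ => 0 end.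

Definition lead_mean (K : nat) (mu : 'I_K -> R) (j : nat) : 'rV[R]_j :=
  \row_(i < j) vf mu i.
Definition lead_cov (K : nat) (S : 'M[R]_K) (j : nat) : 'M[R]_j :=
  \matrix_(i < j, l < j) mf S i l.

(* conditional CDF of component k (0-based) of N(mu, S) given that the
   first k components equal y: ratio of (marginal) densities *)
Definition cond_cdf (K : nat) (mu : 'I_K -> R) (S : 'M[R]_K) (k : nat)
    (y : 'rV[R]_k) (t : R) : R :=
  fine (\int[lebesgue_measure]_(s in [set s : R | s <= t])
          (gauss_dens (lead_mean mu (k + 1)) (lead_cov S (k + 1))
             (row_mx y (const_mx s)))%:E)
  / gauss_dens (lead_mean mu k) (lead_cov S k) y.

Definition quantile (F : R -> R) (u : R) : R := inf [set t | u <= F t].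

Fixpoint cond_inv_seq (K : nat) (mu : 'I_K -> R) (S : 'M[R]_K)
    (u : 'I_K -> R) (k : nat) : seq R :=
  match k with
  | 0 => [::]
  | k'.+1 =>
    let xs := cond_inv_seq mu S u k' in
    rcons xs (quantile (cond_cdf mu S (\row_(i < k') nth 0 xs i)) (vf u k'))
  end.

Definition cond_inv (K : nat) (mu : 'I_K -> R) (S : 'M[R]_K)
    (u : 'I_K -> R) (k : 'I_K) : R :=
  nth 0 (cond_inv_seq mu S u K) k.

Definition theta_hat (K : nat) (theta : 'I_K -> R) (Info : 'M[R]_K)
    (u : 'I_K -> R) (n : R) (k : 'I_K) : R :=
  cond_inv theta (n^-1 *: invmx Info) u k.

Definition p_post (K : nat) (theta : 'I_K -> R) (Info : 'M[R]_K)
    (u : 'I_K -> R) (dL dU : \bar R) (n : R) (k : 'I_K) : R :=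
  let th := theta_hat theta Info u n k in
  let sd := Num.sqrt (n^-1 * invmx Info k k) in
  Phi_ext ((dU - th%:E) * (sd^-1)%:E)%E - Phi_ext ((dL - th%:E) * (sd^-1)%:E)%E.

Definition a_coef (K : nat) (theta : 'I_K -> R) (Info : 'M[R]_K)
    (d : \bar R) (k : 'I_K) : \bar R :=
  ((d - (theta k)%:E) * ((Num.sqrt (invmx Info k k))^-1)%:E)%E.

End Defs.

(* Main.v *)
Require Import Defs.
From HB Require Import structures.
From mathcomp Require Import all_boot all_order all_algebra.
From mathcomp Require Import all_classical all_reals all_analysis.
From mathcomp Require Import ring lra.
Import Order.TTheory GRing.Theory Num.Theory.
Import numFieldNormedType.Exports.
Local Open Scope classical_set_scope.
Local Open Scope ring_scope.

(**
  Scaling the covariance by [1/n] leaves the regression coefficients of the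
  conditional normal laws unchanged and divides their standard deviations by
  [sqrt n]; so, by induction on the component, conditional CDF inversion gives
  [theta_k + c_k / sqrt n] with [c_k] independent of [n], and part (a) holds with
  [b_k = - c_k / sqrt (I^-1)_kk].  For part (b), write [p] or [1 - p] as
  [T (a sqrt n + b) + e T (a' sqrt n + b')], where [T = 1 - Phi] and [0 < a <= a'],
  or as such a tail plus a constant in [(0, 1)] when [theta_k] is an endpoint.
  By the Mills ratio [x T x / phi x -> 1], the logarithmic derivative of
  [T (a sqrt n + b)] tends to [- a^2 / 2]; the term with the larger coefficient
  is negligible, and [logit (1 - p) = - logit p].
*)

(** * Normal distribution functions: derivative, limits, standardization *)

Lemma is_deriveP (R : realType) (f : R -> R) (x d : R) :
  derivable f x 1 -> derive1 f x = d -> is_derive x 1 f d.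
Proof. by move=> df <-; split=> //; rewrite derive1E. Qed.

Lemma std_normal_pdfE (R : realType) : @std_normal_pdf R = normal_pdf 0 1.
Proof.
apply/funext => x; rewrite /std_normal_pdf normal_pdfE ?oner_eq0//.
rewrite /normal_peak /normal_fun subr0 expr1n mul1r mulrC.
by rewrite (mulr_natl pi 2) mulr2n.
Qed.

Lemma Phi_normal_prob (R : realType) (x : R) :
  Phi x = fine (normal_prob 0 1 `]-oo, x]).
Proof. by rewrite /Phi /normal_prob std_normal_pdfE set_itvE. Qed.

Section normal_cdf.
Context {R : realType} (m s : R).
Hypothesis s0 : s != 0.

(** The identity, seen as a random variable under [normal_prob m s], has [F] as its CDF; the general
    limits of a CDF at infinity then apply. *)
Let idR : measurableTypeR R -> R := idfun.

#[local] HB.instance Definition _ :=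
  @isMeasurableFun.Build _ _ _ _ idR (@measurable_id _ _ setT).

Let idRV : {RV (normal_prob m s) >-> R} := idR.

Let F (x : R) : R := fine (normal_prob m s `]-oo, x]).

Lemma is_derive_normal_cdf (x : R) : is_derive x 1 F (normal_pdf m s x).
Proof.
(* Integrating up to [x + 1] makes [x] an interior point, as the fundamental theorem of calculus
   requires. *)
have ltx : x < x + 1 by rewrite ltrDl.
have ifn : lebesgue_measure.-integrable [set` `]-oo, x + 1]]
    (EFin \o normal_pdf m s).
  apply: (@integrableS _ _ _ _ setT) => //; exact: integrable_normal_pdf.
have [] := continuous_FTC1 ltx ifn (ltNyr _) (@continuous_normal_pdf R m s s0 x).
exact: is_deriveP.
Qed.

Lemma cvg_normal_cdfy : F x @[x --> +oo] --> (1 : R).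
Proof.
exact: fine_cvg (@cvg_cdfy1 _ _ R (normal_prob m s) idRV).
Qed.

Lemma cvg_normal_cdfNy : F x @[x --> -oo] --> (0 : R).
Proof.
exact: fine_cvg (@cvg_cdfNy0 _ _ R (normal_prob m s) idRV).
Qed.

End normal_cdf.

(* Used instead of changes of variables to identify CDFs. *)
Lemma derive_eq_cvgNy (R : realType) (f g d : R -> R) (l : R) :
  (forall x : R, is_derive x 1 f (d x)) -> (forall x : R, is_derive x 1 g (d x)) ->
  f x @[x --> -oo] --> l -> g x @[x --> -oo] --> l -> f =1 g.
Proof.
move=> df dg fl gl x.
have D (y : R) : is_derive y 1 (f \- g) 0.
  by rewrite -(subrr (d y)); apply: is_deriveB.
have cst : (f \- g) = cst (f x - g x).
  by apply/funext => y; exact: is_derive_0_is_cst.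
have fg0 : (f \- g) y @[y --> -oo] --> (0 : R).
  by rewrite -(subrr l); apply: cvgB.
have fgx : (f \- g) y @[y --> -oo] --> f x - g x by rewrite cst; exact: cvg_cst.
by apply/eqP; rewrite -subr_eq0; apply/eqP; exact: cvg_unique fgx fg0.
Qed.

(** Both sides have derivative [normal_pdf m s] and tend to 0 at [-oo], hence agree. *)
Lemma normal_prob_itvNy (R : realType) (m s t : R) : 0 < s ->
  fine (normal_prob m s `]-oo, t]) = Phi ((t - m) / s).
Proof.
move=> s0; have sN0 : s != 0 by rewrite gt_eqF.
have dg (x : R) : is_derive x 1 (fun t => Phi ((t - m) / s)) (normal_pdf m s x).
  have dlin : is_derive x 1 (fun t => (t - m) / s) s^-1.
    have -> : (fun t => (t - m) / s) = s^-1 \*: (id - cst m).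
      by apply/funext => y; rewrite /= mulrC.
    apply: is_derive_eq; rewrite subr0; exact: mulr1.
  have := @is_derive1_comp R _ _ x _ _
    (is_derive_normal_cdf 0 1 (oner_neq0 R) ((x - m) / s)) dlin.
  have -> : normal_pdf 0 1 ((x - m) / s) * s^-1 = normal_pdf m s x.
    rewrite !normal_pdfE ?oner_neq0// /normal_peak /normal_fun subr0.
    rewrite mulrAC; congr (_ * _).
      rewrite expr1n mul1r -mulrnAr sqrtrM ?sqr_ge0// sqrtr_sqr gtr0_norm//.
      by rewrite invfM mulrC.
    by congr expR; rewrite expr1n; field.
  by congr (is_derive _ _ _ _); apply/funext => y /=; rewrite Phi_normal_prob.
apply: (@derive_eq_cvgNy R _ (fun t => Phi ((t - m) / s)) _ 0
  (is_derive_normal_cdf m s sN0) dg (@cvg_normal_cdfNy R m s)).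
under eq_fun do rewrite Phi_normal_prob.
have h : (t - m) / s @[t --> -oo] --> -oo.
  apply/cvgrNyPle => A; near=> x.
  rewrite ler_pdivrMr// lerBlDr.
  by near: x; apply: nbhs_ninfty_le; rewrite num_real.
exact: (cvg_comp _ _ h (@cvg_normal_cdfNy R 0 1)).
Unshelve. all: by end_near. Qed.

(** * The standard normal CDF: symmetry, monotonicity, surjectivity onto []0, 1[] *)

Section Phi_facts.
Context {R : realType}.
Implicit Types x y : R.
Local Notation phi := (@std_normal_pdf R).

Lemma std_normal_pdf_gt0 x : 0 < phi x.
Proof. by rewrite divr_gt0 ?expR_gt0// sqrtr_gt0 mulr_gt0// pi_gt0. Qed.

Lemma std_normal_pdfN x : phi (- x) = phi x.
Proof. by rewrite /std_normal_pdf sqrrN. Qed.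

Lemma is_derive_Phi x : is_derive x 1 (@Phi R) (phi x).
Proof.
have -> : @Phi R = fun x => fine (normal_prob 0 1 `]-oo, x]).
  by apply/funext => y; exact: Phi_normal_prob.
by rewrite std_normal_pdfE; apply: is_derive_normal_cdf; rewrite oner_neq0.
Qed.

Lemma cvg_Phiy : Phi x @[x --> +oo] --> (1 : R).
Proof.
by under eq_fun do rewrite Phi_normal_prob; exact: cvg_normal_cdfy.
Qed.

Lemma cvg_PhiNy : Phi x @[x --> -oo] --> (0 : R).
Proof.
by under eq_fun do rewrite Phi_normal_prob; exact: cvg_normal_cdfNy.
Qed.

(** Since the density is even, both sides, once [x] is replaced by [- x], have derivative [phi] and
    limit 0 at [-oo]. *)
Lemma PhiN x : Phi (- x) = 1 - Phi x.
Proof.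
have dN (y : R) : is_derive y 1 (fun x => 1 - Phi (- x)) (phi y).
  have := @is_derive1_comp R _ _ y _ _ (is_derive_Phi (- y)) (is_deriveNid y 1).
  rewrite std_normal_pdfN mulrN1 => dP.
  have := is_deriveB (is_derive_cst (1 : R) y 1) dP.
  by rewrite sub0r opprK.
have cN : 1 - Phi (- x) @[x --> -oo] --> (0 : R).
  rewrite -(subrr (1 : R)); apply: cvgB; first exact: cvg_cst.
  by apply/cvgNy_compNP => /=; rewrite /comp; under eq_fun do rewrite opprK;
    exact: cvg_Phiy.
by rewrite (derive_eq_cvgNy _ _ _ _ _ is_derive_Phi dN cvg_PhiNy cN) opprK.
Qed.

Lemma Phi_lt x y : x < y -> Phi x < Phi y.
Proof.
move=> xy.
have cP z : {for z, continuous (@Phi R)}.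
  by apply/differentiable_continuous/derivable1_diffP; have [] := is_derive_Phi z.
apply: (@gtr0_derive1_lt_cc R _ x y) => //.
- by move=> z _; have [] := is_derive_Phi z.
- by move=> z _; rewrite derive1E; have [_ ->] := is_derive_Phi z;
    exact: std_normal_pdf_gt0.
- by apply: continuous_subspaceT => z; exact: cP.
- by rewrite in_itv/= lexx ltW.
- by rewrite in_itv/= lexx ltW.
Qed.

Lemma Phi_ge0 x : 0 <= Phi x.
Proof. by rewrite Phi_normal_prob fine_ge0// measure_ge0. Qed.

Lemma Phi_gt0 x : 0 < Phi x.
Proof.
by rewrite (le_lt_trans (Phi_ge0 (x - 1)))// Phi_lt// ltrBlDr ltrDl.
Qed.

Lemma Phi_lt1 x : Phi x < 1.
Proof. by rewrite -subr_gt0 -PhiN Phi_gt0. Qed.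

(** Intermediate values between the limits 0 and 1. It lets a level be written [Phi z], the form in
    which conditional quantiles become explicit. *)
Lemma Phi_quantile (v : R) : 0 < v < 1 -> exists z, Phi z = v.
Proof.
move=> /andP[v0 v1].
have [a ha] := filter_ex (cvgr_lt (0 : R) cvg_PhiNy _ v0).
have [b hb] := filter_ex (cvgr_gt (1 : R) cvg_Phiy _ v1).
have ab : a <= b.
  rewrite leNgt; apply/negP => /(Phi_lt b a); rewrite ltNge => /negP; apply.
  exact/ltW/(lt_trans ha).
have cP : {within `[a, b], continuous (@Phi R)}.
  apply: continuous_subspaceT => z.
  by apply/differentiable_continuous/derivable1_diffP; have [] := is_derive_Phi z.
have [|z _ <-] := @IVT _ _ _ _ v ab cP; last by exists z.
by rewrite ge_min le_max (ltW ha) (ltW hb) orbT.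
Qed.

End Phi_facts.

(** * Schur complement of the last diagonal entry *)

Section schur.
Context {R : realType} {k : nat}.
Implicit Types C : 'M[R]_(k + 1).

(** For a covariance matrix [C], this is the variance of the last coordinate given the first [k]. *)
Definition schur C : R :=
  (drsubmx C - dlsubmx C *m invmx (ulsubmx C) *m ursubmx C) 0 0.

(** A test vector for the block, padded with a zero, is a test vector for [C] with the same value of
    the form. *)
Lemma posdef_ulsubmx C : posdef C -> posdef (ulsubmx C).
Proof.
move=> [Csym Cpos]; split; first by rewrite trmx_ulsub Csym.
move=> v v0.
have /Cpos : row_mx v (0 : 'rV_1) != 0.
  by apply: contra_neq v0 => /eqP; rewrite row_mx_eq0 => /andP[/eqP].
by rewrite -[in X in X -> _](submxK C) mul_row_block !mul0mx !addr0 tr_row_mx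
  mul_row_col trmx0 mulmx0 addr0.
Qed.

(* [M C *m C *m (M C)^T = D C]: one step of block Gaussian elimination, from
   which the determinant, the quadratic form and positivity are all read off. *)
Let M C : 'M[R]_(k + 1) :=
  block_mx 1%:M 0 (- (dlsubmx C *m invmx (ulsubmx C))) 1%:M.
Let D C : 'M[R]_(k + 1) := block_mx (ulsubmx C) 0 0 (schur C)%:M.

Let symC C : C^T = C -> dlsubmx C = (ursubmx C)^T.
Proof. by move=> Cs; rewrite trmx_ursub Cs. Qed.

Let mulMCM C : C^T = C -> ulsubmx C \in unitmx -> M C *m C *m (M C)^T = D C.
Proof.
move=> Csym uA.
have Asym : (ulsubmx C)^T = ulsubmx C by rewrite trmx_ulsub Csym.
rewrite -[X in _ *m X *m _](submxK C) /M tr_block_mx !trmx1 !trmx0.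
rewrite mulmx_block !mul1mx !mul0mx !addr0 mulNmx mulmxKV// addNr.
rewrite mulmx_block !mulmx1 !mulmx0 !mul0mx !addr0 add0r.
rewrite linearN/= trmx_mul trmx_inv Asym (symC _ Csym) trmxK mulmxN.
rewrite mulmxA mulmxV// mul1mx addNr; congr block_mx.
rewrite addrC mulNmx.
rewrite [LHS]mx11_scalar; congr _%:M.
by rewrite /schur (symC _ Csym).
Qed.

Let detM C : \det (M C) = 1.
Proof. by rewrite det_lblock !det1 mulr1. Qed.

Lemma det_schur C : C^T = C -> ulsubmx C \in unitmx ->
  \det C = \det (ulsubmx C) * schur C.
Proof.
move=> Csym uA; have := congr1 determinant (mulMCM _ Csym uA).
by rewrite !det_mulmx det_tr detM mul1r mulr1 det_ublock det_scalar1.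
Qed.

(** The last row [e *m M C] of [M C] is nonzero, and the quadratic form of [C] at it equals
    [schur C]. *)
Lemma schur_gt0 C : posdef C -> ulsubmx C \in unitmx -> 0 < schur C.
Proof.
move=> [Csym Cpos] uA.
pose e : 'rV[R]_(k + 1) := row_mx 0 1%:M.
have eM0 : e *m M C != 0.
  rewrite mul_row_block !mul0mx !add0r !mul1mx.
  rewrite row_mx_eq0 negb_and; apply/orP; right.
  by apply/eqP => /matrixP/(_ 0 0); rewrite !mxE/= => /eqP; rewrite oner_eq0.
have := Cpos _ eM0; rewrite trmx_mul !mulmxA -!mulmxA (mulmxA C) (mulmxA (M C)).
rewrite (mulmxA (M C)) mulMCM// mulmxA mul_row_block !mul0mx !add0r mulmx0.
by rewrite mul1mx tr_row_mx mul_row_col trmx0 mulmx0 add0r trmx1 mulmx1 mxE eqxx.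
Qed.

(** Completing the square: inverting the elimination identity gives [invmx C = (M C)^T *m Di *m M C]
    with [Di] block diagonal, and [v *m (M C)^T] only changes the last coordinate, from [t] to its
    regression residual [t - a]. *)
Lemma quad_form_schur C (w : 'rV[R]_k) (t : R) : C^T = C ->
  ulsubmx C \in unitmx -> schur C != 0 ->
  let v : 'rV_(k + 1) := row_mx w (const_mx t) in
  (v *m invmx C *m v^T) 0 0 = (w *m invmx (ulsubmx C) *m w^T) 0 0
    + (t - (w *m invmx (ulsubmx C) *m ursubmx C) 0 0) ^+ 2 / schur C.
Proof.
move=> Csym uA s0 v; set a := (_ *m ursubmx C) 0 0.
have Asym : (ulsubmx C)^T = ulsubmx C by rewrite trmx_ulsub Csym.
pose Di : 'M[R]_(k + 1) := block_mx (invmx (ulsubmx C)) 0 0 (schur C)^-1%:M.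
have DDi : D C *m Di = 1%:M.
  rewrite mulmx_block !mulmx0 !mul0mx !addr0 add0r mulmxV//.
  by rewrite -scalar_mxM divff// scalar_mx_block.
have uM : M C \in unitmx by rewrite unitmxE detM unitr1.
have uC : C \in unitmx.
  by rewrite unitmxE det_schur// unitrM -unitmxE uA unitfE.
have -> : invmx C = (M C)^T *m Di *m M C.
  apply: (can_inj (mulKmx uC)); rewrite mulmxV//.
  apply: (can_inj (mulKmx uM)); rewrite mulmx1 !mulmxA mulMCM//.
  by rewrite DDi mul1mx.
have vM : v *m (M C)^T = row_mx w (const_mx (t - a)).
  rewrite /M tr_block_mx mul_row_block !trmx1 !trmx0 !mulmx1 !mulmx0 addr0.
  congr row_mx; rewrite linearN/= trmx_mul trmx_inv Asym.
  rewrite (symC _ Csym) trmxK mulmxN mulmxA.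
  by apply/matrixP => i j; rewrite !ord1 !mxE addrC /a mxE.
rewrite !mulmxA vM -mulmxA -[M C *m _]trmxK trmx_mul trmxK vM.
rewrite mul_row_block !mulmx0 !addr0 add0r tr_row_mx mul_row_col mxE.
by congr (_ + _); rewrite !mxE big_ord1 !mxE big_ord1 !mxE eqxx mulr1n expr2 mulrAC.
Qed.

End schur.

(** * Conditional laws of a multivariate normal vector *)

Section conditional_normal.
Context {R : realType} {K : nat}.
Variables (mu : 'I_K -> R) (S : 'M[R]_K).
Hypothesis Spd : posdef S.

Lemma lead_cov_full : lead_cov S K = S.
Proof. by apply/matrixP => i j; rewrite mxE /mf !valK. Qed.

Lemma ulsubmx_lead_cov k : ulsubmx (lead_cov S (k + 1)) = lead_cov S k.
Proof. by apply/matrixP => i j; rewrite !mxE. Qed.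

Lemma lead_mean_row k :
  lead_mean mu (k + 1) = row_mx (lead_mean mu k) (const_mx (vf mu k)).
Proof.
apply/rowP => i; rewrite !mxE; case: split_ordP => j ->; rewrite !mxE//.
by rewrite ord1 /= addn0.
Qed.

(** Descending induction from the full matrix, removing the last row and column at each step. *)
Lemma posdef_lead_cov j : (j <= K)%N -> posdef (lead_cov S j).
Proof.
move=> jK; rewrite -(subKn jK); elim: (K - j)%N => [|i IH].
  by rewrite subn0 lead_cov_full.
rewrite subnS; case: (K - i)%N IH => [//|m] IH.
by rewrite -ulsubmx_lead_cov; apply: posdef_ulsubmx; rewrite addn1.
Qed.

(** Each enlargement multiplies the determinant by a positive Schur complement; the induction
    hypothesis supplies the invertibility of the block that this complement inverts. *)
Lemma det_lead_cov_gt0 k : (k <= K)%N -> 0 < \det (lead_cov S k).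
Proof.
elim: k => [|k IH] kK; first by rewrite det_mx00.
have dk := IH (ltnW kK).
have uk : ulsubmx (lead_cov S (k + 1)) \in unitmx.
  by rewrite ulsubmx_lead_cov unitmxE unitfE gt_eqF.
have := posdef_lead_cov _ kK; rewrite -addn1 => pd.
rewrite det_schur//; last by case: pd.
by rewrite mulr_gt0 ?schur_gt0// ulsubmx_lead_cov.
Qed.

Lemma unit_lead_cov k : (k <= K)%N -> lead_cov S k \in unitmx.
Proof. by move=> kK; rewrite unitmxE unitfE gt_eqF// det_lead_cov_gt0. Qed.

Lemma schur_lead_cov_gt0 k : (k < K)%N -> 0 < schur (lead_cov S (k + 1)).
Proof.
move=> kK; apply: schur_gt0; first by rewrite addn1; exact: posdef_lead_cov.
by rewrite ulsubmx_lead_cov unit_lead_cov// ltnW.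
Qed.

Lemma gauss_dens_gt0 k (y : 'rV_k) : (k <= K)%N ->
  0 < gauss_dens (lead_mean mu k) (lead_cov S k) y.
Proof.
move=> kK; rewrite divr_gt0 ?expR_gt0// sqrtr_gt0.
by rewrite mulr_gt0 ?det_lead_cov_gt0// exprn_gt0// mulr_gt0// pi_gt0.
Qed.

(** The regression formula. Components are numbered from 0, so the leading block of size [k + 1] is
    the one holding the covariances of component [k] with its predecessors. *)
Definition cond_mean k (y : 'rV[R]_k) : R := vf mu k +
  ((y - lead_mean mu k) *m invmx (lead_cov S k) *m ursubmx (lead_cov S (k + 1))) 0 0.

Definition cond_sd k : R := Num.sqrt (schur (lead_cov S (k + 1))).

Lemma cond_sd_gt0 k : (k < K)%N -> 0 < cond_sd k.
Proof. by move=> kK; rewrite sqrtr_gt0 schur_lead_cov_gt0. Qed.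

(** Chain rule for densities: [quad_form_schur] splits the exponent and [det_schur] the normalizing
    constant. *)
Lemma gauss_dens_cond k (y : 'rV_k) (t : R) : (k < K)%N ->
  gauss_dens (lead_mean mu (k + 1)) (lead_cov S (k + 1)) (row_mx y (const_mx t))
  = gauss_dens (lead_mean mu k) (lead_cov S k) y
    * normal_pdf (cond_mean k y) (cond_sd k) t.
Proof.
move=> kK; set C := lead_cov S (k + 1).
have kK1 : (k + 1 <= K)%N by rewrite addn1.
have [Csym _] : posdef C by exact: posdef_lead_cov.
have uC : ulsubmx C \in unitmx.
  by rewrite ulsubmx_lead_cov unit_lead_cov// ltnW.
have s0 := schur_lead_cov_gt0 _ kK.
have sd0 := cond_sd_gt0 _ kK.
rewrite normal_pdfE ?gt_eqF// /normal_peak /normal_fun /gauss_dens.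
have -> : row_mx y (const_mx t) - lead_mean mu (k + 1) =
    row_mx (y - lead_mean mu k) (const_mx (t - vf mu k)).
  rewrite lead_mean_row opp_row_mx add_row_mx; congr row_mx.
  by apply/rowP => i; rewrite !mxE.
rewrite quad_form_schur ?gt_eqF// det_schur// {1 2 3}/C ulsubmx_lead_cov.
rewrite sqr_sqrtr ?ltW//.
have -> : t - vf mu k - ((y - lead_mean mu k) *m invmx (lead_cov S k)
   *m ursubmx C) 0 0 = t - cond_mean k y by rewrite /cond_mean opprD addrA.
rewrite opprD mulrDl expRD -!mulrA; congr (_ * _).
rewrite [RHS]mulrA [RHS]mulrC; congr (_ * _).
  by congr expR; field; rewrite gt_eqF.
rewrite -invfM -sqrtrM.
  by congr (Num.sqrt _)^-1; rewrite exprD expr1; ring.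
rewrite mulr_ge0// ?exprn_ge0// ?mulr_ge0 ?pi_ge0//.
by rewrite ltW// det_lead_cov_gt0// ltnW.
Qed.

(** The marginal density of [y] factors out of the integral and cancels the denominator of
    [cond_cdf], leaving a univariate normal CDF. *)
Lemma cond_cdfE k (y : 'rV_k) (t : R) : (k < K)%N ->
  cond_cdf mu S y t = Phi ((t - cond_mean k y) / cond_sd k).
Proof.
move=> kK; have sd0 := cond_sd_gt0 _ kK.
have g0 : 0 < gauss_dens (lead_mean mu k) (lead_cov S k) y.
  by rewrite gauss_dens_gt0// ltnW.
rewrite /cond_cdf.
under eq_integral do rewrite gauss_dens_cond// EFinM.
rewrite integralZl//; last first.
- apply: (@integrableS _ _ _ _ setT) => //; last exact: integrable_normal_pdf.
  by rewrite -set_itvNyc.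
- by rewrite -set_itvNyc.
rewrite -set_itvNyc -normal_prob_itvNy//.
rewrite -[X in fine (_ * X)%E]/(normal_prob (cond_mean k y) (cond_sd k) `]-oo, t]).
rewrite fineM//; last by rewrite fin_num_measure.
by rewrite /= mulrC mulKf// gt_eqF.
Qed.

(** As [Phi] is strictly increasing, the set whose infimum is taken is a closed half-line starting
    at the right-hand side. *)
Lemma quantile_cond_cdf k (y : 'rV_k) (z : R) : (k < K)%N ->
  quantile (cond_cdf mu S y) (Phi z) = cond_mean k y + cond_sd k * z.
Proof.
move=> kK; have sd0 := cond_sd_gt0 _ kK.
rewrite /quantile (_ : [set t | _] = `[cond_mean k y + cond_sd k * z, +oo[%classic).
  by rewrite inf_itv.
apply/seteqP; split=> t /=; rewrite cond_cdfE// in_itv/= andbT.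
  by apply: contraTT; rewrite -!ltNge => h; apply: Phi_lt;
    rewrite ltr_pdivrMr// ltrBlDl mulrC.
rewrite le_eqVlt => /predU1P[<-|h].
  by rewrite addrAC subrr add0r mulrC mulKf ?gt_eqF.
by apply/ltW/Phi_lt; rewrite ltr_pdivlMr// ltrBrDl mulrC.
Qed.

End conditional_normal.

(** * Effect of scaling the covariance on conditional inversion *)

Lemma submxZ (R : realType) (m n : nat) (c : R) (A : 'M[R]_(m + n)) :
  [/\ ulsubmx (c *: A) = c *: ulsubmx A, ursubmx (c *: A) = c *: ursubmx A,
      dlsubmx (c *: A) = c *: dlsubmx A & drsubmx (c *: A) = c *: drsubmx A].
Proof. by split; apply/matrixP => i j; rewrite !mxE. Qed.

Lemma size_cond_inv_seq (R : realType) (K : nat) (mu : 'I_K -> R)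
    (S : 'M[R]_K) (u : 'I_K -> R) k : size (cond_inv_seq mu S u k) = k.
Proof. by elim: k => //= k IH; rewrite size_rcons IH. Qed.

Section conditional_inversion.
Context {R : realType} {K : nat}.
Variables (mu : 'I_K -> R) (S : 'M[R]_K) (u : 'I_K -> R).

Lemma posdefZ (c : R) : 0 < c -> posdef S -> posdef (c *: S).
Proof.
move=> c0 [Ssym Spos]; split; first by rewrite linearZ/= Ssym.
by move=> v v0; rewrite -scalemxAr -scalemxAl mxE mulr_gt0// Spos.
Qed.

Lemma lead_covZ (c : R) k : lead_cov (c *: S) k = c *: lead_cov S k.
Proof.
apply/matrixP => i j; rewrite !mxE /mf.
case: (@insub nat _ 'I_K i) => [a|]; last by rewrite mulr0.
by case: (@insub nat _ 'I_K j) => [b|]; rewrite ?mxE ?mulr0.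
Qed.

(** The factor [c] of the cross-covariances cancels the [c^-1] of the inverted block. *)
Lemma cond_meanZ (c : R) k (y : 'rV[R]_k) : posdef S -> (k < K)%N -> 0 < c ->
  cond_mean mu (c *: S) k y = cond_mean mu S k y.
Proof.
move=> Spd kK c0; rewrite /cond_mean !lead_covZ invmxZ; last first.
  by rewrite unitmxZ ?unitfE ?gt_eqF// unit_lead_cov// ltnW.
have [_ -> _ _] := submxZ _ k 1 c (lead_cov S (k + 1)); rewrite -!scalemxAr -scalemxAl scalerA.
by rewrite mulfV ?gt_eqF// scale1r.
Qed.

(** The Schur complement is homogeneous of degree 1: its second term scales as [c * c^-1 * c]. *)
Lemma cond_sdZ (c : R) k : posdef S -> (k < K)%N -> 0 < c ->
  cond_sd (c *: S) k = Num.sqrt c * cond_sd S k.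
Proof.
move=> Spd kK c0; rewrite /cond_sd -sqrtrM ?ltW//; congr Num.sqrt.
rewrite /schur lead_covZ.
have [-> -> -> ->] := submxZ _ k 1 c (lead_cov S (k + 1)); rewrite invmxZ; last first.
  by rewrite unitmxZ ?unitfE ?gt_eqF// ulsubmx_lead_cov unit_lead_cov// ltnW.
rewrite -!scalemxAl -!scalemxAr -!scalemxAl !scalerA.
by rewrite mulfV ?gt_eqF// mulr1 -scalerBr mxE.
Qed.

Hypothesis Spd : posdef S.
Hypothesis u01 : forall h, 0 < u h < 1.

(** By induction, deviations from the mean scale by [1 / sqrt n]: a conditional mean is linear in
    the earlier deviations with coefficients free of [n], and the conditional standard deviation
    scales likewise. *)
Lemma cond_inv_seq_scale (n : R) k i : 0 < n -> (k <= K)%N -> (i < k)%N ->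
  nth 0 (cond_inv_seq mu (n^-1 *: S) u k) i - vf mu i
  = (nth 0 (cond_inv_seq mu S u k) i - vf mu i) / Num.sqrt n.
Proof.
move=> n0; elim: k i => // k IH i kK.
have Vn0 : 0 < n^-1 by rewrite invr_gt0.
have nSpd := posdefZ _ Vn0 Spd.
rewrite /= !nth_rcons !size_cond_inv_seq ltnS leq_eqVlt.
move=> /predU1P[->|ik]; last by rewrite ik IH// ltnW.
rewrite ltnn eqxx.
(* As [k < K], [vf] returns an entry of [u] and not its default 0, so the level lies strictly
   between 0 and 1. *)
have /Phi_quantile[z <-] : 0 < vf u k < 1 by rewrite /vf insubT.
rewrite !quantile_cond_cdf// cond_meanZ// cond_sdZ//.
rewrite sqrtrV ?ltW//.
rewrite /cond_mean [vf mu k + _ + _]addrAC [vf mu k + _ + _ - _]addrAC.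
set y := \row_(i < k) _; set y1 := \row_(i < k) _.
have -> : y - lead_mean mu k = (Num.sqrt n)^-1 *: (y1 - lead_mean mu k).
  by apply/rowP => j; rewrite !mxE IH ?(ltnW kK)// mulrC.
rewrite -!scalemxAl mxE; ring.
Qed.

Lemma cond_inv_scale (n : R) (k : 'I_K) : 0 < n ->
  cond_inv mu (n^-1 *: S) u k =
  mu k + (cond_inv mu S u k - mu k) / Num.sqrt n.
Proof.
move=> n0; have := cond_inv_seq_scale n K k n0 (leqnn _) (ltn_ord k).
by rewrite /vf valK -/(cond_inv _ _ _ _) => <-; rewrite addrC subrK.
Qed.

End conditional_inversion.

(** * Closed form of the proxy probability *)

Section posdef_theory.
Context {R : realType} {K : nat}.

(** The form of [invmx M] at [v] is the form of [M] at [v *m invmx M]. *)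
Lemma posdef_inv (M : 'M[R]_K) : posdef M -> posdef (invmx M).
Proof.
move=> Mpd; have [Msym Mpos] := Mpd.
have uM : M \in unitmx by rewrite -(lead_cov_full M) unit_lead_cov.
split; first by rewrite trmx_inv Msym.
move=> v v0; have vM0 : v *m invmx M != 0.
  by apply: contra_neq v0 => vM; rewrite -(mulmxKV uM v) vM mul0mx.
by have := Mpos _ vM0; rewrite mulmxKV// trmx_mul trmx_inv Msym mulmxA.
Qed.

Lemma posdef_diag_gt0 (M : 'M[R]_K) (k : 'I_K) : posdef M -> 0 < M k k.
Proof.
move=> [_ Mpos]; have /Mpos : (delta_mx 0 k : 'rV[R]_K) != 0.
  by apply/eqP => /rowP/(_ k); rewrite !mxE !eqxx => /eqP; rewrite oner_eq0.
by rewrite -rowE trmx_delta -colE !mxE.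
Qed.

End posdef_theory.

Section closed_form.
Context {R : realType} {K : nat}.
Variables (theta : 'I_K -> R) (Info : 'M[R]_K) (u : 'I_K -> R) (k : 'I_K).

(** Inversion at [n = 1] determines the constant: by [cond_inv_scale], the standardized deviation of
    [theta_hat] is the same for every positive [n]. *)
Definition b_coef : R :=
  (theta k - cond_inv theta (invmx Info) u k) / Num.sqrt (invmx Info k k).

Hypothesis hpd : posdef Info.
Hypothesis hu : forall h, 0 < u h < 1.

Lemma standardize_theta_hat (n : R) (d : \bar R) : 0 < n ->
  ((d - (theta_hat theta Info u n k)%:E)
     * ((Num.sqrt (n^-1 * invmx Info k k))^-1)%:E)%E =
  (a_coef theta Info d k * (Num.sqrt n)%:E + b_coef%:E)%E.
Proof.
move=> n0; have ipd := posdef_inv _ hpd.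
have s0 := posdef_diag_gt0 _ k ipd.
have sn0 : 0 < Num.sqrt n by rewrite sqrtr_gt0.
have ss0 : 0 < Num.sqrt (invmx Info k k) by rewrite sqrtr_gt0.
rewrite /theta_hat cond_inv_scale// sqrtrM ?invr_ge0 ?ltW// sqrtrV ?ltW//.
rewrite /a_coef /b_coef.
have p1 : 0 < ((Num.sqrt n)^-1 * Num.sqrt (invmx Info k k))^-1.
  by rewrite invr_gt0 mulr_gt0// invr_gt0.
have p2 : 0 < (Num.sqrt (invmx Info k k))^-1 by rewrite invr_gt0.
(* An infinite endpoint is preserved on both sides, the shifts being finite and the factors
   positive. *)
case: d => [d| |] /=.
- rewrite -!EFinB -!EFinM -EFinD; congr EFin; field.
  by rewrite !gt_eqF.
- by rewrite !addye//= !gt0_mulye ?lte_fin.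
- by rewrite !addNye//= !gt0_mulNye ?lte_fin.
Qed.

Lemma p_postE (dL dU : \bar R) (n : R) : 0 < n ->
  p_post theta Info u dL dU n k =
    Phi_ext (a_coef theta Info dU k * (Num.sqrt n)%:E + b_coef%:E)%E
    - Phi_ext (a_coef theta Info dL k * (Num.sqrt n)%:E + b_coef%:E)%E.
Proof. by move=> n0; rewrite /p_post !standardize_theta_hat. Qed.

End closed_form.

(** * Normal tail and Mills ratio *)

Lemma is_derive1_eq (R : realType) (f : R -> R) (x d d' : R) :
  is_derive x 1 f d -> d = d' -> is_derive x 1 f d'.
Proof. by move=> fd <-. Qed.

(** A nonincreasing function stays above its limit. Both Mills bounds follow by applying this to a
    difference that vanishes at infinity. *)
Lemma le0_derive_cvgy0_ge0 (R : realType) (f df : R -> R) (a : R) :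
  (forall x : R, a < x -> is_derive x 1 f (df x)) ->
  (forall x, a < x -> df x <= 0) ->
  f x @[x --> +oo] --> (0 : R) -> forall x, a < x -> 0 <= f x.
Proof.
move=> fd df0 f0 x ax; apply: (cvgr_to_le f0); near=> y.
have xy : x <= y by near: y; apply: nbhs_pinfty_ge; rewrite num_real.
have dz z : a < z -> derivable f z 1 by move=> /fd[].
apply: (@ler0_derive1_le_cc R f x y); rewrite ?in_itv/= ?lexx ?xy//.
- by move=> z; rewrite in_itv/= => /andP[xz _]; apply/dz/(lt_trans ax).
- move=> z; rewrite in_itv/= => /andP[xz _]; have az := lt_trans ax xz.
  by rewrite derive1E; have [_ ->] := fd _ az; exact: df0.
- apply: derivable_within_continuous => z; rewrite in_itv/= => /andP[xz _].
  exact/dz/(lt_le_trans ax).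
Unshelve. all: by end_near. Qed.

Section normal_tail.
Context {R : realType}.
Implicit Types x y : R.
Local Notation phi := (@std_normal_pdf R).

(** By symmetry ([PhiN]), the upper tail [1 - Phi x]. *)
Definition tail x := Phi (- x).

Lemma is_derive_tail x : is_derive x 1 tail (- phi x).
Proof.
have := @is_derive1_comp R _ _ x _ _ (is_derive_Phi (- x)) (is_deriveNid x 1).
by rewrite std_normal_pdfN mulrN1.
Qed.

Lemma is_derive_std_normal_pdf x : is_derive x 1 phi (- x * phi x).
Proof.
have d2 : is_derive x 1 (fun y : R => - y ^+ 2 / 2) (- x).
  have -> : (fun y : R => - y ^+ 2 / 2) = (- 2^-1) \*: (id ^+ 2).
    by apply/funext => y; rewrite /= !fctE /GRing.scale/= mulrC mulrN mulNr.
  apply: is_derive_eq; rewrite /GRing.scale/= expr1 mulr1 mulrA.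
  by field.
have de := @is_derive1_comp R _ _ x _ _ (is_derive_expR _) d2.
have -> : phi = (Num.sqrt (2 * pi))^-1 \*: (expR \o (fun y : R => - y ^+ 2 / 2)).
  by apply/funext => y; rewrite /= /std_normal_pdf /GRing.scale/= mulrC.
apply: is_derive_eq; rewrite /std_normal_pdf/= /GRing.scale/=; ring.
Qed.

Lemma tail_gt0 x : 0 < tail x.
Proof. exact: Phi_gt0. Qed.

Lemma cvg_tail : tail x @[x --> +oo] --> (0 : R).
Proof. by have /cvgNy_compNP := @cvg_PhiNy R. Qed.

Lemma std_normal_pdf_le x : phi x <= phi 0.
Proof.
rewrite ler_pM2r ?invr_gt0 ?sqrtr_gt0 ?mulr_gt0 ?pi_gt0//.
by rewrite ler_expR expr0n oppr0 mul0r mulr_le0_ge0// oppr_le0 sqr_ge0.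
Qed.

Lemma cvg_invr_y : x^-1 @[x --> +oo] --> (0 : R).
Proof.
apply/gtr0_cvgV0; last exact: cvg_id.
by near=> x; near: x; apply: nbhs_pinfty_gt; rewrite num_real.
Unshelve. all: by end_near. Qed.

Lemma cvg_std_normal_pdf_divr : phi x / x @[x --> +oo] --> (0 : R).
Proof.
apply: (@squeeze_cvgr _ _ _ _ (cst 0) (fun x => phi 0 * x^-1)).
- near=> x; have x0 : 0 < x.
    by near: x; apply: nbhs_pinfty_gt; rewrite num_real.
  rewrite /= (divr_ge0 (ltW (std_normal_pdf_gt0 x)) (ltW x0))/= ler_pM2r ?invr_gt0//.
  exact: std_normal_pdf_le.
- exact: cvg_cst.
- by rewrite -[X in _ --> X](mulr0 (phi 0)); apply: cvgMl_tmp; exact: cvg_invr_y.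
Unshelve. all: by end_near. Qed.

(** The difference [phi x / x - tail x] has derivative [- phi x / x ^+ 2] and vanishes at
    infinity. *)
Lemma tail_le x : 0 < x -> tail x <= phi x / x.
Proof.
move=> x0; rewrite -subr_ge0.
apply: (@le0_derive_cvgy0_ge0 R (fun x => phi x / x - tail x)
  (fun x => - phi x / x ^+ 2) 0) => //.
- move=> y y0; have yN0 : y != 0 by rewrite gt_eqF.
  have dV := is_deriveV (f := id) yN0 (is_derive_id y 1).
  have := is_deriveB (is_deriveM (is_derive_std_normal_pdf y) dV)
    (is_derive_tail y).
  by move=> h; apply: (is_derive1_eq _ _ _ _ _ h); rewrite /GRing.scale/=; field.
- by move=> y y0; rewrite mulNr oppr_le0 divr_ge0 ?sqr_ge0// ltW ?std_normal_pdf_gt0.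
- rewrite -(subrr (0 : R)); apply: cvgB; first exact: cvg_std_normal_pdf_divr.
  exact: cvg_tail.
Qed.

(** The difference has the negative derivative [- 2 phi x / (1 + x ^+ 2) ^+ 2] and vanishes at
    infinity. *)
Lemma tail_ge x : 0 < x -> phi x * (x / (1 + x ^+ 2)) <= tail x.
Proof.
move=> x0; rewrite -subr_ge0.
have p2 y : 0 < 1 + y ^+ 2 by rewrite ltr_wpDr// sqr_ge0.
apply: (@le0_derive_cvgy0_ge0 R (fun x => tail x - phi x * (x / (1 + x ^+ 2)))
  (fun x => - (2 * phi x / (1 + x ^+ 2) ^+ 2)) 0) => //.
- move=> y y0; have yN0 : 1 + y ^+ 2 != 0 by rewrite gt_eqF.
  have d2 : is_derive y 1 (fun y : R => 1 + y ^+ 2) (2 * y).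
    have := is_deriveD (is_derive_cst (1 : R) y 1)
      (is_deriveX 2 (is_derive_id y 1)).
    by move=> h; apply: (is_derive1_eq _ _ _ _ _ h); rewrite /GRing.scale/=; ring.
  have dV := is_deriveV (f := fun y => 1 + y ^+ 2) yN0 d2.
  have := is_deriveB (is_derive_tail y) (is_deriveM (is_derive_std_normal_pdf y)
    (is_deriveM (is_derive_id y 1) dV)).
  move=> h; apply: (is_derive1_eq _ _ _ _ _ h); rewrite /GRing.scale/= !fctE.
  by field.
- move=> y y0; rewrite oppr_le0 divr_ge0 ?sqr_ge0// mulr_ge0// ltW//.
  exact: std_normal_pdf_gt0.
- rewrite -(subrr (0 : R)); apply: cvgB; first exact: cvg_tail.
  apply: (@squeeze_cvgr _ _ _ _ (cst 0) (fun x => phi x / x)).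
  + near=> y; have y0 : 0 < y.
      by near: y; apply: nbhs_pinfty_gt; rewrite num_real.
    rewrite /= mulr_ge0 ?(ltW (std_normal_pdf_gt0 _))//=; last first.
      by rewrite divr_ge0 ?ltW.
    rewrite ler_pM2l ?std_normal_pdf_gt0// ler_pdivrMr//.
    by rewrite mulrDr mulr1 expr2 mulKf ?gt_eqF// lerDr invr_ge0 ltW.
  + exact: cvg_cst.
  + exact: cvg_std_normal_pdf_divr.
Unshelve. all: by end_near. Qed.

Lemma cvg_mills : phi x / (x * tail x) @[x --> +oo] --> (1 : R).
Proof.
(* [tail_ge] bounds the ratio by [1 + x ^- 2], which is at most [1 + x^-1] once [1 <= x]; [tail_le]
   gives the lower bound 1. *)
apply: (@squeeze_cvgr _ _ _ _ (cst 1) (fun x => 1 + x^-1)).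
- near=> x; have x1 : 1 <= x.
    by near: x; apply: nbhs_pinfty_ge; rewrite num_real.
  have x0 := lt_le_trans ltr01 x1.
  have t0 := tail_gt0 x.
  rewrite /= ler_pdivlMr ?mulr_gt0// mul1r mulrC -ler_pdivlMr// tail_le//=.
  rewrite ler_pdivrMr ?mulr_gt0//.
  have := tail_ge x x0; rewrite mulrA ler_pdivrMr ?ltr_wpDr ?sqr_ge0// => h.
  rewrite -(ler_pM2r x0) (le_trans h)//.
  rewrite (_ : (1 + x^-1) * _ * x = tail x * (x ^+ 2 + x)); last first.
    by field; rewrite gt_eqF.
  by rewrite ler_pM2l// addrC lerD2l.
- exact: cvg_cst.
- by rewrite -[X in _ --> X]addr0; apply: cvgD;
    [exact: cvg_cst|exact: cvg_invr_y].
Unshelve. all: by end_near. Qed.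

End normal_tail.

(** * Limiting slope of a logit *)

Section logit_slope.
Context {R : realType}.
Implicit Types (q dq : R -> R) (l : R).

(** Bundles eventual differentiability with the limit of the derivative, so that both pass together
    to complements and to functions equal for positive [n]. *)
Definition logit_slope q l := exists2 d : R -> R,
  (\forall n \near +oo, is_derive (n : R) 1 (fun m => logit (q m)) (d n)) &
  d n @[n --> +oo] --> l.

(** The chain rule gives [logit (q)' = q' / (q (1 - q))]. *)
Lemma logit_slope_intro q dq l :
  (\forall n \near +oo, is_derive (n : R) 1 q (dq n)) ->
  (\forall n \near +oo, 0 < q n < 1) ->
  dq n / (q n * (1 - q n)) @[n --> +oo] --> l -> logit_slope q l.
Proof.
move=> qd q01 dl; exists (fun n => dq n / (q n * (1 - q n))) => //.
near=> n; have /andP[q0 q1] : 0 < q n < 1 by near: n.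
have dqn : is_derive n 1 q (dq n) by near: n.
have q1' : 0 < 1 - q n by rewrite subr_gt0.
have d1 := @is_derive1_comp R _ _ n _ _ (is_derive1_ln q0) dqn.
have d2' := is_deriveB (is_derive_cst (1 : R) n 1) dqn.
have d2 := @is_derive1_comp R _ _ n _ _ (is_derive1_ln q1') d2'.
have h := is_deriveB d1 d2; apply: (is_derive1_eq _ _ _ _ _ h).
by field; rewrite !gt_eqF.
Unshelve. all: by end_near. Qed.

Lemma logit_slopeC q l : logit_slope q l -> logit_slope (fun n => 1 - q n) (- l).
Proof.
move=> [d qd dl]; exists (fun n => - d n); last exact: cvgN.
apply: filterS qd => n qd.
rewrite (_ : (fun m => logit (1 - q m)) = - (fun m => logit (q m))).
  exact: is_deriveN.
by apply/funext => m; rewrite /logit subKr opprB.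
Qed.

Lemma eq_logit_slope q q' l : (forall n, 0 < n -> q n = q' n) ->
  logit_slope q l -> logit_slope q' l.
Proof.
move=> qq' [d qd dl]; exists d => //; near=> n.
have n0 : 0 < n by near: n; apply: nbhs_pinfty_gt; rewrite num_real.
apply: (@near_eq_is_derive _ _ _ (fun m => logit (q m))); last by near: n.
near=> m; rewrite qq'//; near: m; exact: lt_nbhsr.
Unshelve. all: by end_near. Qed.

Lemma logit_slope_derive1 q l : logit_slope q l ->
  (\forall n \near +oo, derivable (fun m => logit (q m)) (n : R) 1) /\
  derive1 (fun m => logit (q m)) n @[n --> +oo] --> l.
Proof.
move=> [d qd dl]; split; first by apply: filterS qd => n [].
apply: cvg_trans dl; apply: near_eq_cvg; apply: filterS qd => n [_ <-].
by rewrite derive1E.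
Qed.

End logit_slope.

(** * Normal tails along [a * sqrt n + b] *)

Section tail_sqrt.
Context {R : realType}.
Implicit Types a b : R.
Local Notation phi := (@std_normal_pdf R).

Lemma cvg_sqrt_y : Num.sqrt n @[n --> (+oo : set_system R)] --> +oo.
Proof.
apply/cvgryPge => A; near=> n.
apply: le_trans (ler_norm A) _; rewrite -sqrtr_sqr; apply: ler_wsqrtr.
by near: n; apply: nbhs_pinfty_ge; rewrite num_real.
Unshelve. all: by end_near. Qed.

Lemma cvg_affine_y a b : 0 < a -> a * x + b @[x --> +oo] --> +oo.
Proof.
move=> a0; apply/cvgryPge => A; near=> x.
rewrite -lerBlDr -(ler_pdivrMl _ _ a0).
by near: x; apply: nbhs_pinfty_ge; rewrite num_real.
Unshelve. all: by end_near. Qed.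

Lemma cvg_affine_sqrt_y a b : 0 < a ->
  a * Num.sqrt n + b @[n --> +oo] --> +oo.
Proof. move=> a0; exact: (cvg_comp _ _ cvg_sqrt_y (cvg_affine_y a b a0)). Qed.

Definition tail_sqrt a b (n : R) := tail (a * Num.sqrt n + b).

Definition dtail_sqrt a b (n : R) :=
  - phi (a * Num.sqrt n + b) * (a * (2 * Num.sqrt n)^-1).

Lemma tail_sqrt_gt0 a b n : 0 < tail_sqrt a b n.
Proof. exact: tail_gt0. Qed.

Lemma is_derive_tail_sqrt a b (n : R) : 0 < n ->
  is_derive n 1 (tail_sqrt a b) (dtail_sqrt a b n).
Proof.
move=> n0.
have d1 : is_derive n 1 (fun n => a * Num.sqrt n + b) (a * (2 * Num.sqrt n)^-1).
  have h := is_deriveD (is_deriveZ a (is_derive1_sqrt n0)) (is_derive_cst b n 1).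
  by apply: (is_derive1_eq _ _ _ _ _ h); rewrite addr0.
exact: (@is_derive1_comp R _ _ n _ _ (is_derive_tail _) d1).
Qed.

Lemma cvg_tail_sqrt a b : 0 < a -> tail_sqrt a b n @[n --> +oo] --> (0 : R).
Proof.
by move=> a0; exact: (cvg_comp _ _ (cvg_affine_sqrt_y a b a0) cvg_tail).
Qed.

(** With [x = a * sqrt n + b], the quotient is [- (a / 2) * (x / sqrt n) * (phi x / (x * tail x))];
    the last two factors tend to [a] and 1. *)
Lemma cvg_dlog_tail_sqrt a b : 0 < a ->
  dtail_sqrt a b n / tail_sqrt a b n @[n --> +oo] --> - a ^+ 2 / 2.
Proof.
move=> a0.
have Vs : (Num.sqrt n)^-1 @[n --> (+oo : set_system R)] --> (0 : R).
  exact: (cvg_comp _ _ cvg_sqrt_y cvg_invr_y).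
have l1 : a + b * (Num.sqrt n)^-1 @[n --> (+oo : set_system R)] --> a.
  rewrite -[X in _ --> X]addr0; apply: cvgD; first exact: cvg_cst.
  by rewrite -[X in _ --> X](mulr0 b); exact: cvgMl_tmp.
have l2 := cvg_comp _ _ (cvg_affine_sqrt_y a b a0) cvg_mills.
rewrite (_ : - a ^+ 2 / 2 = - (a / 2) * (a * 1)); last by field.
apply: cvg_trans (cvgM (cvg_cst (- (a / 2))) (cvgM l1 l2)).
apply: near_eq_cvg; near=> n.
have x0 : 0 < a * Num.sqrt n + b.
  by near: n; apply: cvgry_gt; exact: cvg_affine_sqrt_y.
have n0 : 0 < Num.sqrt n by near: n; apply: cvgry_gt; exact: cvg_sqrt_y.
have t0 := tail_gt0 (a * Num.sqrt n + b).
rewrite /= /dtail_sqrt /tail_sqrt; field.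
by rewrite !gt_eqF.
Unshelve. all: by end_near. Qed.

Lemma cvg_tail_sqrt_ratio a b a' b' : 0 < a -> a < a' ->
  tail_sqrt a' b' n / tail_sqrt a b n @[n --> +oo] --> (0 : R).
Proof.
move=> a0 aa'; have d0 : 0 < a' - a by rewrite subr_gt0.
have a'0 := lt_trans a0 aa'.
(* The factor 2 comes from [1 / (2 x) <= x / (1 + x ^+ 2)] in [tail_ge], and the exponent from
   [x' - x <= x' ^+ 2 - x ^+ 2], both for [1 <= x <= x']. *)
pose g n : R := 2 * expR (- (2^-1 * ((a' - a) * Num.sqrt n + (b' - b)))).
apply: (@squeeze_cvgr _ _ _ _ (cst 0) g).
- near=> n; rewrite /g /tail_sqrt.
  set x := a * _ + b; set x' := a' * _ + b'.
  have -> : (a' - a) * Num.sqrt n + (b' - b) = x' - x by rewrite /x /x'; ring.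
  have x1 : 1 <= x by rewrite /x; near: n; apply: cvgry_ge; exact: cvg_affine_sqrt_y.
  have xx' : 0 <= x' - x.
    rewrite (_ : x' - x = (a' - a) * Num.sqrt n + (b' - b)); last first.
      by rewrite /x /x'; ring.
    by near: n; apply: cvgry_ge; exact: cvg_affine_sqrt_y.
  have x0 := lt_le_trans ltr01 x1.
  have x'0 : 0 < x' by lra.
  rewrite divr_ge0 ?(ltW (tail_gt0 _))//= ler_pdivrMr ?tail_gt0//.
  apply: le_trans (tail_le x' x'0) _.
  have h1 : phi x' <= expR (- (2^-1 * (x' - x))) * phi x.
    rewrite /std_normal_pdf mulrA ler_pM2r ?invr_gt0 ?sqrtr_gt0 ?mulr_gt0 ?pi_gt0//.
    by rewrite -expRD ler_expR; nra.
  have h2 : 2^-1 / x <= x / (1 + x ^+ 2).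
    rewrite ler_pdivrMr// mulrAC ler_pdivlMr ?ltr_wpDr ?sqr_ge0//; nra.
  have e0 := expR_gt0 (- (2^-1 * (x' - x))).
  have p0 := std_normal_pdf_gt0 x.
  apply: (@le_trans _ _ (2 * expR (- (2^-1 * (x' - x))) * (phi x * (2^-1 / x)))).
    rewrite ler_pdivrMr// (le_trans h1)// [leRHS](_ : _ =
      expR (- (2^-1 * (x' - x))) * phi x * (x' / x)); last by field; rewrite gt_eqF.
    apply: ler_peMr; first by rewrite mulr_ge0// ltW.
    by rewrite ler_pdivlMr// mul1r; lra.
  rewrite ler_pM2l ?mulr_gt0// (le_trans _ (tail_ge x x0))//.
  by rewrite ler_pM2l.
- exact: cvg_cst.
- rewrite -[X in _ --> X](mulr0 2); apply: cvgMl_tmp.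
  have hy : 2^-1 * ((a' - a) * Num.sqrt n + (b' - b)) @[n --> +oo] --> +oo.
    under eq_fun do rewrite mulrDr mulrA.
    by apply: cvg_affine_sqrt_y; rewrite mulr_gt0// invr_gt0.
  exact: (cvg_comp _ _ hy (@cvgr_expR R)).
Unshelve. all: by end_near. Qed.

(** If [a < a'], the second tail is negligible whatever the sign of [e]. If [a = a'], both tails
    have the same limiting logarithmic derivative, and [0 <= e] keeps the weight [w] in [[0, 1]]. *)
Lemma logit_slope_tail a b a' b' e : 0 < a -> a < a' \/ a = a' /\ 0 <= e ->
  logit_slope (fun n => tail_sqrt a b n + e * tail_sqrt a' b' n) (- a ^+ 2 / 2).
Proof.
move=> a0 aa'.
have a'0 : 0 < a' by case: aa' => [|[<-]//]; exact: lt_trans.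
set q := fun n => _.
pose f n := dtail_sqrt a b n / tail_sqrt a b n.
pose g n := dtail_sqrt a' b' n / tail_sqrt a' b' n.
pose r n := e * (tail_sqrt a' b' n / tail_sqrt a b n).
(* With [q = F + e G] and [w = e G / q], [q' / q = F' / F + (G' / G - F' / F) w]. *)
pose w n := r n / (1 + r n).
have f_cvg : f n @[n --> +oo] --> - a ^+ 2 / 2 by exact: cvg_dlog_tail_sqrt.
have g_cvg : g n @[n --> +oo] --> - a' ^+ 2 / 2 by exact: cvg_dlog_tail_sqrt.
have r_cvg : a < a' -> r n @[n --> +oo] --> (0 : R).
  move=> laa'; rewrite -[X in _ --> X](mulr0 e); apply: cvgMl_tmp.
  exact: cvg_tail_sqrt_ratio.
have r_ge0 n : 0 <= e -> 0 <= r n.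
  by move=> e0; rewrite mulr_ge0// divr_ge0// ltW// tail_sqrt_gt0.
have r1_gt0 : \forall n \near +oo, 0 < 1 + r n.
  case: aa' => [laa'|[_ e0]]; last first.
    by near=> n; rewrite ltr_wpDr// r_ge0.
  apply: filterS (cvgr_gt _ (r_cvg laa') (-1) _) => [n|]; last by rewrite ltrN10.
  by rewrite -ltrBlDl sub0r.
have w_cvg : (g n - f n) * w n @[n --> +oo] --> (0 : R).
  case: aa' => [laa'|[eaa' e0]].
    rewrite -[X in _ --> X](mulr0 (- a' ^+ 2 / 2 - - a ^+ 2 / 2)).
    apply: cvgM; first exact: cvgB.
    rewrite -[X in _ --> X](mul0r (1 + 0)^-1); apply: cvgM; first exact: r_cvg.
    apply: cvgV; first by rewrite addr0 oner_neq0.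
    by apply: cvgD; [exact: cvg_cst|exact: r_cvg].
  apply: norm_cvg0; apply: (@squeeze_cvgr _ _ _ _ (cst 0) (fun n => `|g n - f n|)).
  - near=> n; rewrite normr_ge0 normrM ler_piMr//=.
    rewrite ger0_norm ?divr_ge0 ?addr_ge0 ?r_ge0//.
    by rewrite ler_pdivrMr ?ltr_wpDr ?r_ge0// mul1r lerDr.
  - exact: cvg_cst.
  - rewrite -(normr0 R) -(subrr (- a ^+ 2 / 2)); apply: cvg_norm.
    by apply: cvgB => //; rewrite [in X in _ --> X]eaa'.
have q_cvg : q n @[n --> +oo] --> (0 : R).
  rewrite -(addr0 (0 : R)) -[X in _ --> _ + X](mulr0 e); apply: cvgD.
    exact: cvg_tail_sqrt.
  by apply: cvgMl_tmp; exact: cvg_tail_sqrt.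
have qE n : q n = tail_sqrt a b n * (1 + r n).
  by rewrite /q /r; field; rewrite gt_eqF// tail_sqrt_gt0.
apply: (@logit_slope_intro _ _ (fun n => dtail_sqrt a b n + e * dtail_sqrt a' b' n)).
- near=> n; have n0 : 0 < n by near: n; apply: nbhs_pinfty_gt; rewrite num_real.
  exact: is_deriveD (is_derive_tail_sqrt a b n n0)
    (is_deriveZ e (is_derive_tail_sqrt a' b' n n0)).
- near=> n; apply/andP; split; last by near: n; apply: (cvgr_lt (0 : R)).
  by rewrite qE mulr_gt0 ?tail_sqrt_gt0//; near: n.
(* Since [q] tends to 0, the factor [1 - q] tends to 1 and only [q' / q] matters. *)
- have : (f n + (g n - f n) * w n) / (1 - q n) @[n --> +oo] -->
      (- a ^+ 2 / 2 + 0) / (1 - 0).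
    apply: cvgM; first exact: cvgD.
    apply: cvgV; first by rewrite subr0 oner_neq0.
    by apply: cvgB => //; exact: cvg_cst.
  rewrite addr0 subr0 divr1; apply: cvg_trans; apply: near_eq_cvg; near=> n.
  have q1 : 0 < 1 - q n.
    by rewrite subr_gt0; near: n; apply: (cvgr_lt (0 : R)).
  have r1 : 0 < 1 + r n by near: n.
  have F0 := tail_sqrt_gt0 a b n; have G0 := tail_sqrt_gt0 a' b' n.
  have q0 : 0 < q n by rewrite qE mulr_gt0.
  rewrite [in RHS]invfM [RHS]mulrA; congr (_ / _).
  have q0' : 0 < tail_sqrt a b n + e * tail_sqrt a' b' n by exact: q0.
  move: q0 r1; rewrite qE /w /f /g /r => q0 r1.
field.
  by rewrite !gt_eqF.
Unshelve. all: by end_near. Qed.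

(** Here [q (1 - q)] tends to [c (1 - c) > 0], while the derivative of the tail, its logarithmic
    derivative times itself, tends to 0. *)
Lemma logit_slope_cst_tail c a b e : 0 < c < 1 -> 0 < a ->
  logit_slope (fun n => c + e * tail_sqrt a b n) 0.
Proof.
move=> /andP[c0 c1] a0; set q := fun n => _.
have q_cvg : q n @[n --> +oo] --> c.
  rewrite -[X in _ --> X]addr0; apply: cvgD; first exact: cvg_cst.
  by rewrite -[X in _ --> X](mulr0 e); apply: cvgMl_tmp; exact: cvg_tail_sqrt.
apply: (@logit_slope_intro _ _ (fun n => e * dtail_sqrt a b n)).
- near=> n; have n0 : 0 < n by near: n; apply: nbhs_pinfty_gt; rewrite num_real.
  have h := is_deriveD (is_derive_cst c n 1)
    (is_deriveZ e (is_derive_tail_sqrt a b n n0)).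
  by apply: (is_derive1_eq _ _ _ _ _ h); rewrite add0r.
- near=> n; apply/andP; split; near: n; [exact: (cvgr_gt c)|exact: (cvgr_lt c)].
- rewrite -(mul0r (c * (1 - c))^-1); apply: cvgM; last first.
    apply: cvgV; first by rewrite mulf_neq0// gt_eqF// subr_gt0.
    by apply: cvgM => //; apply: cvgB => //; exact: cvg_cst.
  rewrite -[X in _ --> X](mulr0 e); apply: cvgM; first exact: cvg_cst.
  rewrite -(mulr0 (- a ^+ 2 / 2)).
  apply: cvg_trans (cvgM (cvg_dlog_tail_sqrt a b a0) (cvg_tail_sqrt a b a0)).
  apply: near_eq_cvg; near=> n.
  by rewrite /= divfK// gt_eqF// tail_sqrt_gt0.
Unshelve. all: by end_near. Qed.

End tail_sqrt.

(** * Slopes for one and two interval endpoints *)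

Section logit_slope_Phi.
Context {R : realType}.
Implicit Types a b : R.

Lemma Phi_tail_sqrtN a b (n : R) :
  Phi (a * Num.sqrt n + b) = tail_sqrt (- a) (- b) n.
Proof. by rewrite /tail_sqrt /tail mulNr -opprD opprK. Qed.

Lemma Phi_tail_sqrt a b (n : R) :
  Phi (a * Num.sqrt n + b) = 1 - tail_sqrt a b n.
Proof. by rewrite /tail_sqrt /tail PhiN subKr. Qed.

(** One finite endpoint: the value is a tail if [a < 0], the complement of one if [a > 0], constant
    if [a = 0]; the product of [a] with its absolute value carries the sign. *)
Lemma logit_slope_Phi a b :
  logit_slope (fun n => Phi (a * Num.sqrt n + b)) (a * `|a| / 2).
Proof.
have ltS (x : R) : x < x + 1 by rewrite ltrDl.
have [a0|a0|->] := ltgtP a 0.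
- have Na0 : 0 < - a by rewrite oppr_gt0.
  (* With [e = 0] the second tail is absent; [- a + 1] is merely some coefficient larger than
     [- a]. *)
  have h := logit_slope_tail (- a) (- b) (- a + 1) 0 0 Na0 (or_introl (ltS _)).
  rewrite ltr0_norm// (_ : a * - a / 2 = - (- a) ^+ 2 / 2); last by field.
  apply: eq_logit_slope h => n _.
  by rewrite mul0r addr0 Phi_tail_sqrtN.
- have h := logit_slope_tail a b (a + 1) 0 0 a0 (or_introl (ltS a)).
  have := logit_slopeC _ _ h; rewrite mulNr opprK gtr0_norm// -expr2 => hC.
  apply: eq_logit_slope hC => n _.
  by rewrite mul0r addr0 Phi_tail_sqrt.
- rewrite mul0r mul0r.
  have Phi01 : 0 < Phi b < 1 by rewrite Phi_gt0 Phi_lt1.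
  apply: eq_logit_slope (logit_slope_cst_tail (Phi b) 1 b 0 Phi01 ltr01) => n _.
  by rewrite !mul0r addr0 add0r.
Qed.

(** If [a] and [a'] have the same sign, the difference is one tail minus a smaller-order one. If
    [a < 0 < a'], its complement is a sum of two tails. If one of them is 0, the difference tends to
    a constant in []0, 1[] and the minimum is 0. *)
Lemma logit_slope_PhiB a a' b : a < a' ->
  logit_slope (fun n => Phi (a' * Num.sqrt n + b) - Phi (a * Num.sqrt n + b))
    ((2^-1 - (if a < 0 < a' then 0 else 1)) * Num.min (a' * a') (a * a)).
Proof.
move=> aa'.
have Phi01 : 0 < Phi b < 1 by rewrite Phi_gt0 Phi_lt1.
have [a'0|a'0|a'0] := ltgtP a' 0.
- have a0 := lt_trans aa' a'0.
  have Na'0 : 0 < - a' by rewrite oppr_gt0.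
  have h := logit_slope_tail (- a') (- b) (- a) (- b) (-1) Na'0.
  rewrite andbF (min_idPl _); last by nra.
  rewrite (_ : _ * (a' * a') = - (- a') ^+ 2 / 2); last by field.
  apply: eq_logit_slope (h _) => [n _|]; last by left; rewrite ltrN2.
  by rewrite !Phi_tail_sqrtN mulN1r.
- have [a0|a0|a0] := ltgtP a 0; rewrite /= ?subr0.
  + have Na0 : 0 < - a by rewrite oppr_gt0.
    have [a'a|aNa'] := leP a' (- a).
      (* In the tie [a' = - a] neither tail dominates; it is admissible because [e = 1] is
         nonnegative. *)
      have h : a' < - a \/ a' = - a /\ 0 <= (1 : R).
        by move: a'a; rewrite le_eqVlt => /predU1P[|]; [right|left].
      have := logit_slopeC _ _ (logit_slope_tail a' b (- a) (- b) 1 a'0 h).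
      rewrite (min_idPl _); last by nra.
      rewrite (_ : - (- a' ^+ 2 / 2) = 2^-1 * (a' * a')); last by field.
      apply: eq_logit_slope => n _.
      by rewrite Phi_tail_sqrt (Phi_tail_sqrtN a) mul1r opprD addrA.
    have := logit_slopeC _ _ (logit_slope_tail (- a) (- b) a' b 1 Na0 (or_introl aNa')).
    rewrite (min_idPr _); last by nra.
    rewrite (_ : - (- (- a) ^+ 2 / 2) = 2^-1 * (a * a)); last by field.
    apply: eq_logit_slope => n _.
    by rewrite Phi_tail_sqrt (Phi_tail_sqrtN a) mul1r opprD addrA addrAC.
  + have h := logit_slope_tail a b a' b (-1) a0 (or_introl aa').
    rewrite (min_idPr _); last by nra.
    rewrite (_ : _ * (a * a) = - a ^+ 2 / 2); last by field.
    apply: eq_logit_slope h => n _.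
    by rewrite !Phi_tail_sqrt; ring.
  + rewrite a0 mulr0 (min_idPr _) ?mulr_ge0 ?ltW// mulr0.
    have Phi01' : 0 < 1 - Phi b < 1 by rewrite -PhiN Phi_gt0 Phi_lt1.
    apply: eq_logit_slope (logit_slope_cst_tail _ a' b (-1) Phi01' a'0) => n _.
    by rewrite Phi_tail_sqrt mul0r add0r mulN1r addrAC.
- have Na0 : 0 < - a by rewrite oppr_gt0 -a'0.
  rewrite a'0 mulr0 (min_idPl _); last by rewrite -mulrNN mulr_ge0 ?ltW.
  rewrite mulr0.
  apply: eq_logit_slope (logit_slope_cst_tail _ (- a) (- b) (-1) Phi01 Na0) => n _.
  by rewrite (Phi_tail_sqrtN a) mul0r add0r mulN1r.
Qed.

(** Not both endpoints are infinite, so the minimum is finite; an infinite one has square [+oo] and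
    drops out of it. *)
Lemma logit_slope_Phi_ext (a a' : \bar R) b :
  (a < a')%E -> (a != -oo)%E || (a' != +oo)%E ->
  exists2 l : R,
    logit_slope (fun n => Phi_ext (a' * (Num.sqrt n)%:E + b%:E)%E
                          - Phi_ext (a * (Num.sqrt n)%:E + b%:E)%E) l &
    l%:E = ((2^-1 - (if (a < 0 < a')%E then 0 else 1))%:E *
            Order.min (a' * a') (a * a))%E.
Proof.
have y (n : R) : 0 < n -> (+oo * (Num.sqrt n)%:E + b%:E)%E = +oo%E.
  by move=> n0; rewrite gt0_mulye ?lte_fin ?sqrtr_gt0// addye.
have Ny (n : R) : 0 < n -> (-oo * (Num.sqrt n)%:E + b%:E)%E = -oo%E.
  by move=> n0; rewrite gt0_mulNye ?lte_fin ?sqrtr_gt0// addNye.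
have minyl (x : R) : Order.min (+oo%E) (x%:E * x%:E)%E = (x * x)%:E.
  by rewrite minye EFinM.
have minyr (x : R) : Order.min (x%:E * x%:E)%E (+oo%E) = (x * x)%:E.
  by rewrite miney EFinM.
case: a => [a| |]; case: a' => [a'| |] //= aa' _.
- exists ((2^-1 - (if a < 0 < a' then 0 else 1)) * Num.min (a' * a') (a * a)).
    by apply: logit_slope_PhiB; rewrite -lte_fin.
  by rewrite !lte_fin -!EFinM -EFin_min EFinM.
- exists (- (a * `|a| / 2)).
    apply: eq_logit_slope (logit_slopeC _ _ (logit_slope_Phi a b)) => n n0.
    by rewrite y.
  rewrite ltry andbT lte_fin mulyy minyl -EFinM; congr EFin.
  by case: ltP => a0; [rewrite ltr0_norm//|rewrite ger0_norm//]; field.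
- exists (a' * `|a'| / 2).
    apply: eq_logit_slope (logit_slope_Phi a' b) => n n0.
    by rewrite Ny//= subr0.
  rewrite ltNyr /= lte_fin mulNyNy minyr -EFinM; congr EFin.
  by case: ltP => a0; [rewrite gtr0_norm//|rewrite ler0_norm//]; field.
Qed.

End logit_slope_Phi.

Theorem theorem1 (R : realType) (K : nat) (hK : (1 <= K)%N)
  (theta : 'I_K -> R) (Info : 'M[R]_K) (hpd : posdef Info)
  (u : 'I_K -> R) (hu : forall h, 0 < u h < 1) (k : 'I_K) :
  (exists b : R, forall dL dU : \bar R, (dL < dU)%E ->
     forall n : R, 0 < n ->
       p_post theta Info u dL dU n k =
         Phi_ext (a_coef theta Info dU k * (Num.sqrt n)%:E + b%:E)%E
         - Phi_ext (a_coef theta Info dL k * (Num.sqrt n)%:E + b%:E)%E)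
  /\
  (forall dL dU : \bar R, (dL < dU)%E ->
     (dL != -oo)%E || (dU != +oo)%E ->
     (\forall n \near +oo,
        derivable (fun m : R => logit (p_post theta Info u dL dU m k)) n 1)
     /\
     (derive1 (fun m : R => logit (p_post theta Info u dL dU m k)) n)%:E
        @[n --> +oo] -->
       ((2^-1 - (if (dL < (theta k)%:E < dU)%E then 0 else 1))%:E *
        Order.min (a_coef theta Info dU k * a_coef theta Info dU k)
                  (a_coef theta Info dL k * a_coef theta Info dL k))%E).
Proof.
have ipd := posdef_inv _ hpd.
have s0 : 0 < (Num.sqrt (invmx Info k k))^-1.
  by rewrite invr_gt0 sqrtr_gt0; exact: posdef_diag_gt0.
split.
  by exists (b_coef theta Info u k) => dL dU _ n n0; exact: p_postE.
move=> dL dU dLU fin.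
(* [a_coef] is a shift followed by a positive scaling, so order, signs relative to [theta k] and
   finiteness carry over from the endpoints. *)
have aLU : (a_coef theta Info dL k < a_coef theta Info dU k)%E.
  by rewrite /a_coef lte_pmul2r// lteD2rE.
have aL0 : (a_coef theta Info dL k < 0)%E = (dL < (theta k)%:E)%E.
  by rewrite /a_coef pmule_llt0 ?lte_fin// sube_lt0 ?orbT.
have aU0 : (0 < a_coef theta Info dU k)%E = ((theta k)%:E < dU)%E.
  by rewrite /a_coef pmule_lgt0 ?lte_fin// sube_gt0.
have afin : (a_coef theta Info dL k != -oo)%E || (a_coef theta Info dU k != +oo)%E.
  have aNy d : d != -oo%E -> a_coef theta Info d k != -oo%E.
    by case: d => [d| |] // _; rewrite /a_coef/= gt0_mulye.
  have ay d : d != +oo%E -> a_coef theta Info d k != +oo%E.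
    by case: d => [d| |] // _; rewrite /a_coef/= gt0_mulNye.
  by case/orP: fin => h; apply/orP; [left; exact: aNy|right; exact: ay].
have [l slope lE] := logit_slope_Phi_ext _ _ (b_coef theta Info u k) aLU afin.
rewrite -aL0 -aU0 -lE.
have := eq_logit_slope _ (fun m => p_post theta Info u dL dU m k) _ _ slope.
move=> /(_ (fun n n0 => esym (p_postE theta Info u k hpd hu dL dU n n0))).
move=> /logit_slope_derive1[dp lp]; split=> //.
by apply: cvg_EFin; [exact: nearW|exact: lp].
Qed.
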